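(* Let $\delta>0$ and assume: (A1) $\boldsymbol f$ is twice continuously differentiable on $B(\boldsymbol s,\delta)$; (A2) $\|\tilde{\boldsymbol F}\|\le\max_{\boldsymbol x\in B(\boldsymbol s,\delta)}\|\boldsymbol F(\boldsymbol x)\|=L<1$; (A3) $\boldsymbol x_0\in B(\boldsymbol s,\delta)$, and $\boldsymbol x_{m+1}=\boldsymbol f(\boldsymbol x_m)$ for $m=0,1,\ldots$. Let $k\ge1$ be a fixed integer such that for every $n\ge 0$ the vector $\boldsymbol\epsilon_n$ is nonzero and $k$ is at most the degree of the minimal polynomial of $\tilde{\boldsymbol F}$ with respect to $\boldsymbol\epsilon_n$, and assume: (A4) there is a fixed $\eta>0$ such that $\|\tilde{\boldsymbol W}^{+}\|_2\le \eta/\|\boldsymbol\epsilon_n\|$ for every $n\ge 0$, where $\tilde{\boldsymbol W}=\tilde{\boldsymbol W}_{n,k}$. Then the RRE approximations $\boldsymbol s_{n,k}$ satisfy $\lim_{n\to\infty}\boldsymbol s_{n,k}=\boldsymbol s$ and $$\limsup_{n\to\infty}\frac{\|\boldsymbol s_{n,k}-\boldsymbol s\|}{\|\boldsymbol\epsilon_n\|}\le\theta_k<1 .$$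
   Context: Setting: $\boldsymbol f:\mathbb C^N\to\mathbb C^N$, $\boldsymbol s$ is a solution of $\boldsymbol x=\boldsymbol f(\boldsymbol x)$, $\boldsymbol F(\boldsymbol x)$ is the Jacobian matrix of $\boldsymbol f$ at $\boldsymbol x$, $\tilde{\boldsymbol F}=\boldsymbol F(\boldsymbol s)$ with $\rho(\tilde{\boldsymbol F})<1$, and $\boldsymbol G=\boldsymbol I-\tilde{\boldsymbol F}$ (nonsingular). $\|\cdot\|_2$ is the standard $l_2$ vector norm and its induced matrix norm. $\|\boldsymbol z\|=\|\boldsymbol G\boldsymbol z\|_2$ for $\boldsymbol z\in\mathbb C^N$, and for $N\times N$ matrices $\|\boldsymbol A\|=\|\boldsymbol G\boldsymbol A\boldsymbol G^{-1}\|_2$ is the induced norm. $B(\boldsymbol s,\delta)=\{\boldsymbol x:\|\boldsymbol x-\boldsymbol s\|\le\delta\}$. Put $\boldsymbol\epsilon_m=\boldsymbol x_m-\boldsymbol s$. Reduced Rank Extrapolation (RRE): with $\boldsymbol u_m=\boldsymbol x_{m+1}-\boldsymbol x_m$, $\boldsymbol w_m=\boldsymbol u_{m+1}-\boldsymbol u_m$, and the $N\times k$ matrices $\boldsymbol U=[\boldsymbol u_n|\cdots|\boldsymbol u_{n+k-1}]$, $\boldsymbol W=[\boldsymbol w_n|\cdots|\boldsymbol w_{n+k-1}]$, the RRE approximation is $\boldsymbol s_{n,k}=\boldsymbol x_n-\boldsymbol U\boldsymbol W^{+}\boldsymbol u_n$, where $^{+}$ is the Moore–Penrose inverse. (Equivalently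 $\boldsymbol s_{n,k}=\sum_{i=0}^k\gamma_i\boldsymbol x_{n+i}$ with the $\gamma_i$ minimizing $\|\sum_{i=0}^k\gamma_i\boldsymbol u_{n+i}\|_2$ subject to $\sum_{i=0}^k\gamma_i=1$.) The matrix $\tilde{\boldsymbol W}=\tilde{\boldsymbol W}_{n,k}$ is the $N\times k$ matrix with columns $\tilde{\boldsymbol w}_{n+i}=(\tilde{\boldsymbol F}-\boldsymbol I)^2\tilde{\boldsymbol F}^{\,i}\boldsymbol\epsilon_n$, $i=0,\ldots,k-1$. The minimal polynomial of $\boldsymbol T$ with respect to a nonzero vector $\boldsymbol u$ is the monic polynomial $P$ of smallest degree with $P(\boldsymbol T)\boldsymbol u=\boldsymbol 0$. $\theta_k=\min_{g\in\tilde{\mathcal P}_k}\|g(\tilde{\boldsymbol F})\|_2$, where $\tilde{\mathcal P}_k=\{g(z)=\sum_{j=0}^k\alpha_jz^j:\ g(1)=1\}$. *)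

(* Defs.v *)
From HB Require Import structures.
From mathcomp Require Import all_boot all_order all_algebra complex.
From mathcomp Require Import all_classical all_reals all_analysis.

Set Implicit Arguments.
Unset Strict Implicit.
Unset Printing Implicit Defensive.

Import Order.TTheory GRing.Theory Num.Theory.
Import numFieldNormedType.Exports.

Local Open Scope classical_set_scope.
Local Open Scope ring_scope.
Local Open Scope sesquilinear_scope.

(* The library equips an abstract numFieldType with its norm topology, but not
   the concrete type R[i].  Limits, 'D_v and differentiability over R[i] are
   therefore complex ones. *)
HB.instance Definition _ (R : realType) := NormedModule.copy R[i] R[i]^o.

Definition l2norm {R : realType} {n : nat} (z : 'cV[R[i]]_n) : R :=
  Num.sqrt (\sum_(i < n) (ComplexField.Normc.normc (z i 0)) ^+ 2).

Definition l2mxnorm {R : realType} {m n : nat} (A : 'M[R[i]]_(m, n)) : R :=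
  sup [set l2norm (A *m z) | z in [set z : 'cV[R[i]]_n | l2norm z <= 1]].

Definition Gnorm {R : realType} {n : nat} (G : 'M[R[i]]_n)
  (z : 'cV[R[i]]_n) : R := l2norm (G *m z).

Definition Gmxnorm {R : realType} {n : nat} (G A : 'M[R[i]]_n) : R :=
  l2mxnorm (G *m A *m invmx G).

Definition Gball {R : realType} {n : nat} (G : 'M[R[i]]_n)
  (s : 'cV[R[i]]_n) (delta : R) : set 'cV[R[i]]_n :=
  [set x | Gnorm G (x - s) <= delta].

Definition spectral_radius {R : realType} {n : nat} (A : 'M[R[i]]_n) : R :=
  sup [set ComplexField.Normc.normc a | a in [set a | eigenvalue A a]].

(* Row i, column j holds the partial derivative of f_i with respect to x_j;
   the library's [jacobian] acts on row vectors and is the transpose. *)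
Definition jacobian_mx {R : realType} {n : nat}
  (f : 'cV[R[i]]_n -> 'cV[R[i]]_n) (x : 'cV[R[i]]_n) : 'M[R[i]]_n :=
  \matrix_(i, j) 'D_(delta_mx j 0) (fun y => f y i 0) x.

(* f is defined on the whole space, so the derivatives at a point of A
   (boundary points included) are the ordinary two-sided ones: f is
   differentiable around the point, its Jacobian matrix is differentiable at
   the point, and the second-order partial derivatives are continuous on A. *)
Definition twice_continuously_differentiable_on {R : realType} {n : nat}
  (A : set 'cV[R[i]]_n) (f : 'cV[R[i]]_n -> 'cV[R[i]]_n) : Prop :=
  [/\ forall x, A x -> \forall y \near x, differentiable f y,
      forall x, A x -> differentiable (jacobian_mx f) x
    & forall j : 'I_n,
        {within A, continuous (fun x => 'D_(delta_mx j 0) (jacobian_mx f) x)}].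

Definition is_max {R : realType} (S : set R) (m : R) : Prop :=
  S m /\ ubound S m.

Definition is_moore_penrose {R : realType} {m n : nat}
  (A : 'M[R[i]]_(m, n)) (X : 'M[R[i]]_(n, m)) : Prop :=
  [/\ A *m X *m A = A, X *m A *m X = X,
      (A *m X) ^t* = A *m X & (X *m A) ^t* = X *m A].

(* The Penrose equations have exactly one solution, so the default 0 is never
   used. *)
Definition moore_penrose {R : realType} {m n : nat}
  (A : 'M[R[i]]_(m, n)) : 'M[R[i]]_(n, m) :=
  xget 0 [set X | is_moore_penrose A X].

Definition is_minpoly_wrt {R : realType} {n : nat}
  (T : 'M[R[i]]_n.+1) (u : 'cV[R[i]]_n.+1) (P : {poly R[i]}) : Prop :=
  [/\ P \is monic, horner_mx T P *m u = 0
    & forall Q : {poly R[i]}, Q \is monic -> horner_mx T Q *m u = 0 ->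
        (size P <= size Q)%N].

Definition rre_u {R : realType} {N : nat} (x : nat -> 'cV[R[i]]_N) (m : nat) :
  'cV[R[i]]_N := x m.+1 - x m.

Definition rre_w {R : realType} {N : nat} (x : nat -> 'cV[R[i]]_N) (m : nat) :
  'cV[R[i]]_N := rre_u x m.+1 - rre_u x m.

Definition rre_U {R : realType} {N : nat} (x : nat -> 'cV[R[i]]_N)
  (n k : nat) : 'M[R[i]]_(N, k) := \matrix_(i < N, j < k) rre_u x (n + j)%N i 0.

Definition rre_W {R : realType} {N : nat} (x : nat -> 'cV[R[i]]_N)
  (n k : nat) : 'M[R[i]]_(N, k) := \matrix_(i < N, j < k) rre_w x (n + j)%N i 0.

Definition rre {R : realType} {N : nat} (x : nat -> 'cV[R[i]]_N)
  (n k : nat) : 'cV[R[i]]_N :=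
  x n - rre_U x n k *m moore_penrose (rre_W x n k) *m rre_u x n.

Definition W_tilde {R : realType} {N : nat} (F : 'M[R[i]]_N.+1)
  (eps : 'cV[R[i]]_N.+1) (k : nat) : 'M[R[i]]_(N.+1, k) :=
  \matrix_(i < N.+1, j < k) ((F - 1) ^+ 2 *m F ^+ j *m eps) i 0.

(* The infimum is a minimum: it is the distance from 0 to an affine subspace of
   a finite-dimensional space. *)
Definition theta {R : realType} {N : nat} (F : 'M[R[i]]_N.+1) (k : nat) : R :=
  inf [set l2mxnorm (horner_mx F g) |
        g in [set g : {poly R[i]} | (size g <= k.+1)%N /\ g.[1] = 1]].

(* Main.v *)
(* Only the first-order expansion f(s + d) = s + F d + o(d) matters (here F is
   the Jacobian matrix at s and G = 1 - F).  By the mean value inequality, f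
   contracts the ball towards s with ratio L in the norm |G z|, so e_n = x_n - s
   tends to 0 and, up to o(|e_n|),
     u_(n+j) = (F - 1) F^j e_n,   w_(n+j) = (F - 1)^2 F^j e_n,   G U = - W.
   Writing xi = W^+ u_n, the last relation gives
     G (s_(n,k) - s) = (G e_n + u_n) - (u_n - W xi) - (G U + W) xi.
   Assumption (A4) and a perturbation argument bound W^+ by O(1/|e_n|), so xi is
   bounded and the outer two terms are o(|e_n|).  The middle one is the least
   squares residual of u_n against W; for each g with g(1) = 1 it is at most
   |sum_j g_j u_(n+j)| = |g(F) G e_n| + o(|e_n|).  Optimizing over g gives
   theta_k, and g = X gives theta_k <= |F| <= L < 1. *)
Require Import Defs.
From HB Require Import structures.
From mathcomp Require Import all_boot all_order all_algebra complex.
From mathcomp Require Import all_classical all_reals all_analysis.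
From mathcomp Require Import ring lra.
Set Implicit Arguments.
Unset Strict Implicit.
Unset Printing Implicit Defensive.

Import Order.TTheory GRing.Theory Num.Theory.
Import numFieldNormedType.Exports.

Local Open Scope classical_set_scope.
Local Open Scope ring_scope.

(** * The real inner product behind the l2 norm *)

Section RealInnerProduct.
Context {R : realType}.
Implicit Types (n m p : nat).

Lemma ReD (a b : R[i]) : complex.Re (a + b) = complex.Re a + complex.Re b.
Proof. by case: a; case: b. Qed.

Lemma Re_sum (I : Type) (r : seq I) (F : I -> R[i]) :
  complex.Re (\sum_(i <- r) F i) = \sum_(i <- r) complex.Re (F i).
Proof. by apply: (big_morph _ ReD). Qed.

Lemma conj_complexE (z : R[i]) : Num.conj z = conjc z.
Proof.
have [->|z0] := eqVneq z 0; first by rewrite !rmorph0.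
by apply: (mulfI z0); rewrite -normCK sqr_normc.
Qed.

(** The real part of the Hermitian product ([rdotE]). It induces the same norm, and being
    real-valued it admits order arguments and the scalar mean value theorem. *)
Definition rdot n (a b : 'cV[R[i]]_n) : R :=
  \sum_i (complex.Re (a i 0) * complex.Re (b i 0)
          + complex.Im (a i 0) * complex.Im (b i 0)).

Lemma rdotE n (a b : 'cV[R[i]]_n) :
  rdot a b = complex.Re ((map_mx Num.conj (trmx a) *m b) 0 0).
Proof.
rewrite mxE Re_sum; apply: eq_bigr => i _; rewrite !mxE conj_complexE.
by case: (a i 0) => ar ai; case: (b i 0) => br bi /=; ring.
Qed.

Lemma rdotC n (a b : 'cV[R[i]]_n) : rdot a b = rdot b a.
Proof. by apply: eq_bigr => i _; rewrite mulrC [X in _ + X]mulrC. Qed.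

Lemma rdotDr n (a b c : 'cV[R[i]]_n) : rdot a (b + c) = rdot a b + rdot a c.
Proof. by rewrite !rdotE mulmxDr mxE ReD. Qed.

Lemma rdotZr n t (a b : 'cV[R[i]]_n) : rdot a (t%:C%C *: b) = t * rdot a b.
Proof.
rewrite /rdot mulr_sumr; apply: eq_bigr => i _; rewrite mxE.
by case: (b i 0) => br bi /=; ring.
Qed.

Lemma rdotNr n (a b : 'cV[R[i]]_n) : rdot a (- b) = - rdot a b.
Proof.
rewrite /rdot -sumrN; apply: eq_bigr => i _; rewrite mxE.
by case: (b i 0) => br bi /=; ring.
Qed.

Lemma rdotBr n (a b c : 'cV[R[i]]_n) : rdot a (b - c) = rdot a b - rdot a c.
Proof. by rewrite rdotDr rdotNr. Qed.

Lemma rdotDl n (a b c : 'cV[R[i]]_n) : rdot (a + b) c = rdot a c + rdot b c.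
Proof. by rewrite ![rdot _ c]rdotC rdotDr. Qed.

Lemma rdotZl n t (a b : 'cV[R[i]]_n) : rdot (t%:C%C *: a) b = t * rdot a b.
Proof. by rewrite ![rdot _ b]rdotC rdotZr. Qed.

Lemma rdot_adj m n (A : 'M[R[i]]_(m, n)) a b :
  rdot (A *m a) b = rdot a (map_mx Num.conj (trmx A) *m b).
Proof. by rewrite !rdotE trmx_mul map_mxM mulmxA. Qed.

Lemma rdot_ge0 n (a : 'cV[R[i]]_n) : 0 <= rdot a a.
Proof. by apply: sumr_ge0 => i _; rewrite -!expr2 addr_ge0 ?sqr_ge0. Qed.

Lemma sqr_normc_ReIm (z : R[i]) :
  ComplexField.Normc.normc z ^+ 2 =
  complex.Re z * complex.Re z + complex.Im z * complex.Im z.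
Proof.
case: z => a b /=; rewrite sqr_sqrtr ?expr2 //.
by rewrite addr_ge0 ?sqr_ge0.
Qed.

Lemma l2normE n (a : 'cV[R[i]]_n) : l2norm a = Num.sqrt (rdot a a).
Proof.
by congr Num.sqrt; apply: eq_bigr => i _; rewrite sqr_normc_ReIm.
Qed.

Lemma sqr_l2norm n (a : 'cV[R[i]]_n) : l2norm a ^+ 2 = rdot a a.
Proof. by rewrite l2normE sqr_sqrtr ?rdot_ge0. Qed.

Lemma l2norm_ge0 n (a : 'cV[R[i]]_n) : 0 <= l2norm a.
Proof. exact: sqrtr_ge0. Qed.

Lemma le_l2norm n m (a : 'cV[R[i]]_n) (b : 'cV[R[i]]_m) :
  (l2norm a <= l2norm b) = (rdot a a <= rdot b b).
Proof. by rewrite -!sqr_l2norm ler_sqr ?nnegrE ?l2norm_ge0. Qed.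

Lemma l2norm_eq0 n (a : 'cV[R[i]]_n) : l2norm a = 0 -> a = 0.
Proof.
move=> a0; have /eqP : rdot a a = 0 by rewrite -sqr_l2norm a0 expr0n.
rewrite psumr_eq0 => [/allP h|i _]; last by rewrite -!expr2 addr_ge0 ?sqr_ge0.
apply/matrixP => i j; rewrite ord1 mxE; move: (h i (mem_index_enum i)).
rewrite /= -sqr_normc_ReIm sqrf_eq0 => /eqP.
exact: ComplexField.Normc.eq0_normc.
Qed.

Lemma l2norm0 n : l2norm (0 : 'cV[R[i]]_n) = 0.
Proof.
rewrite l2normE -[X in rdot _ X](scale0r (0 : 'cV[R[i]]_n)).
by rewrite -[0 : R[i]]/(0%:C)%C rdotZr mul0r sqrtr0.
Qed.

Lemma l2norm_gt0 n (a : 'cV[R[i]]_n) : a != 0 -> 0 < l2norm a.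
Proof.
move=> a0; rewrite lt_def l2norm_ge0 andbT.
by apply: contra a0 => /eqP /l2norm_eq0 ->.
Qed.

Lemma normr_normcE (z : R[i]) : `|z| = ((ComplexField.Normc.normc z)%:C)%C.
Proof. by []. Qed.

Lemma normc_ge0 (z : R[i]) : 0 <= ComplexField.Normc.normc z.
Proof. by case: z => a b; apply: sqrtr_ge0. Qed.

Lemma l2normZ n c (a : 'cV[R[i]]_n) :
  l2norm (c *: a) = ComplexField.Normc.normc c * l2norm a.
Proof.
rewrite /l2norm -[X in X * _]ger0_norm ?normc_ge0 // -sqrtr_sqr.
rewrite -sqrtrM ?sqr_ge0 // mulr_sumr; congr Num.sqrt.
by apply: eq_bigr => i _; rewrite mxE ComplexField.Normc.normcM exprMn.
Qed.

Lemma l2normZr n (t : R) (a : 'cV[R[i]]_n) :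
  l2norm (t%:C%C *: a) = `|t| * l2norm a.
Proof. by rewrite l2normZ /= expr0n /= addr0 sqrtr_sqr. Qed.

Lemma l2normN n (a : 'cV[R[i]]_n) : l2norm (- a) = l2norm a.
Proof. by rewrite !l2normE rdotNr rdotC rdotNr opprK. Qed.

(** Cauchy-Schwarz: for nonzero a and b, expanding the square of |b| a - |a| b gives 0 <= 2 |a| |b|
    (|a| |b| - [rdot a b]), and the positive factor cancels. *)
Lemma rdot_le n (a b : 'cV[R[i]]_n) : rdot a b <= l2norm a * l2norm b.
Proof.
have [->|a0] := eqVneq a 0.
  rewrite l2norm0 mul0r -[0 : 'cV__](scale0r 0).
  by rewrite -[0 : R[i]]/(0%:C)%C rdotZl mul0r.
have [->|b0] := eqVneq b 0.
  rewrite l2norm0 mulr0 -[0 : 'cV__](scale0r 0).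
  by rewrite -[0 : R[i]]/(0%:C)%C rdotZr mul0r.
have pa := l2norm_gt0 a0; have pb := l2norm_gt0 b0.
have := rdot_ge0 ((l2norm b)%:C%C *: a - (l2norm a)%:C%C *: b).
rewrite rdotBr rdotZr rdotZr !(rdotC _ a) !(rdotC _ b) !rdotBr !rdotZr.
rewrite -!sqr_l2norm (rdotC b a) => h.
have p : 0 < l2norm a * l2norm b by rewrite mulr_gt0.
have {}h : 0 <= 2 * (l2norm a * l2norm b) * (l2norm a * l2norm b - rdot a b).
  by apply: le_trans h _; rewrite le_eqVlt; apply/orP; left; apply/eqP; ring.
by move: h; rewrite pmulr_rge0 ?subr_ge0 // mulr_gt0.
Qed.

Lemma l2normD n (a b : 'cV[R[i]]_n) : l2norm (a + b) <= l2norm a + l2norm b.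
Proof.
rewrite -ler_sqr ?nnegrE ?addr_ge0 ?l2norm_ge0 //.
rewrite sqr_l2norm rdotDr !rdotDl sqrrD !sqr_l2norm (rdotC b a).
have := rdot_le a b; lra.
Qed.

Lemma l2normB n (a b : 'cV[R[i]]_n) : l2norm (a - b) <= l2norm a + l2norm b.
Proof. by rewrite -(l2normN b) l2normD. Qed.

Lemma l2norm_sum n (I : Type) (r : seq I) (F : I -> 'cV[R[i]]_n) :
  l2norm (\sum_(i <- r) F i) <= \sum_(i <- r) l2norm (F i).
Proof.
elim/big_ind2: _ => [|u a v b ua vb|//]; first by rewrite l2norm0.
by apply: le_trans (l2normD _ _) _; apply: lerD.
Qed.

Lemma normc_le_l2norm n (a : 'cV[R[i]]_n) i :
  ComplexField.Normc.normc (a i 0) <= l2norm a.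
Proof.
rewrite -ler_sqr ?nnegrE ?normc_ge0 ?l2norm_ge0 // sqr_l2norm sqr_normc_ReIm.
rewrite /rdot (bigD1 i) //= lerDl.
by apply: sumr_ge0 => j _; rewrite -!expr2 addr_ge0 ?sqr_ge0.
Qed.

Lemma mulmx_cV_sum m n (A : 'M[R[i]]_(m, n)) (z : 'cV[R[i]]_n) :
  A *m z = \sum_j z j 0 *: col j A.
Proof.
apply/colP => i; rewrite mxE summxE; apply: eq_bigr => j _.
by rewrite !mxE mulrC.
Qed.

(** A crude operator bound: it makes the supremum in [l2mxnorm] finite and later turns columnwise
    smallness into smallness of a matrix. *)
Lemma l2norm_mulmx_col m n (A : 'M[R[i]]_(m, n)) (z : 'cV[R[i]]_n) :
  l2norm (A *m z) <= (\sum_j l2norm (col j A)) * l2norm z.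
Proof.
rewrite mulmx_cV_sum (le_trans (l2norm_sum _ _)) // mulr_suml.
apply: ler_sum => j _; rewrite l2normZ mulrC.
by apply: ler_wpM2l; rewrite ?l2norm_ge0 ?normc_le_l2norm.
Qed.

Lemma has_ubound_l2mxnorm m n (A : 'M[R[i]]_(m, n)) :
  has_ubound [set l2norm (A *m z) | z in [set z | l2norm z <= 1]].
Proof.
exists (\sum_j l2norm (col j A)) => _ [w /= w1 <-].
apply: le_trans (l2norm_mulmx_col _ _) _; rewrite ler_piMr //.
by apply: sumr_ge0 => j _; apply: l2norm_ge0.
Qed.

Lemma l2norm_mulmx m n (A : 'M[R[i]]_(m, n)) (z : 'cV[R[i]]_n) :
  l2norm (A *m z) <= l2mxnorm A * l2norm z.
Proof.
have [->|z0] := eqVneq z 0; first by rewrite mulmx0 !l2norm0 mulr0.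
have pz := l2norm_gt0 z0.
rewrite -ler_pdivrMr //; apply: (ub_le_sup (has_ubound_l2mxnorm A)).
exists ((l2norm z)^-1%:C%C *: z) => /=.
  by rewrite l2normZr ger0_norm ?invr_ge0 ?l2norm_ge0 // mulVf ?gt_eqF.
by rewrite -scalemxAr l2normZr ger0_norm ?invr_ge0 ?l2norm_ge0 // mulrC.
Qed.

Lemma l2mxnorm_ge0 m n (A : 'M[R[i]]_(m, n)) : 0 <= l2mxnorm A.
Proof.
apply: (ub_le_sup (has_ubound_l2mxnorm A)).
by exists 0; rewrite /= ?mulmx0 l2norm0.
Qed.

End RealInnerProduct.

(** * Moore-Penrose inverses, least squares and perturbation *)

Section MoorePenrose.
Context {R : realType}.
Local Open Scope sesquilinear_scope.

Definition injective_mx m n (A : 'M[R[i]]_(m, n)) : Prop :=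
  forall z : 'cV[R[i]]_n, A *m z = 0 -> z = 0.

Lemma injective_unitmx n (A : 'M[R[i]]_n) : injective_mx A -> A \in unitmx.
Proof.
move=> injA; rewrite -unitmx_tr -row_free_unit; apply: inj_row_free => v.
move=> /(congr1 trmx); rewrite trmx_mul trmxK trmx0 => /injA /(congr1 trmx).
by rewrite trmxK trmx0.
Qed.

(** Injectivity makes H, the adjoint of A times A, invertible, because pairing z with H z gives |A
    z|^2; then H^-1 times the adjoint of A satisfies the Penrose equations. *)
Lemma is_moore_penrose_exists m n (A : 'M[R[i]]_(m, n)) :
  injective_mx A -> exists X, is_moore_penrose A X.
Proof.
move=> injA; pose H := A ^t* *m A.
have uH : H \in unitmx.
  apply: injective_unitmx => z Hz; apply: injA; apply: l2norm_eq0.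
  by rewrite l2normE rdot_adj mulmxA Hz rdotE mulmx0 mxE sqrtr0.
have VA : invmx H *m A ^t* *m A = 1%:M by rewrite -mulmxA mulVmx.
exists (invmx H *m A ^t*); split.
- by rewrite -mulmxA VA mulmx1.
- by rewrite VA mul1mx.
- rewrite mulmxA !trmx_mul !map_mxM /= trmxCK -!mulmxA; congr (_ *m (_ *m _)).
  rewrite trmx_inv map_invmx; congr invmx.
  by rewrite trmx_mul map_mxM /= trmxCK.
- by rewrite VA trmx1 map_mx1.
Qed.

Lemma moore_penroseP m n (A : 'M[R[i]]_(m, n)) :
  injective_mx A -> is_moore_penrose A (moore_penrose A).
Proof.
move=> /is_moore_penrose_exists [X AX].
by rewrite /moore_penrose; case: xgetP => [Y _ //|/(_ X)].
Qed.

Lemma moore_penroseK m n (A : 'M[R[i]]_(m, n)) (z : 'cV_n) :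
  injective_mx A -> moore_penrose A *m (A *m z) = z.
Proof.
move=> injA; have [AXA _ _ _] := moore_penroseP injA.
apply/eqP; rewrite -subr_eq0; apply/eqP/injA.
by rewrite mulmxBr !mulmxA AXA subrr.
Qed.

(** Since A X is Hermitian and A X A = A, pairing A z with A X y is the same as pairing it with
    y. *)
Lemma moore_penrose_orth m n (A : 'M[R[i]]_(m, n)) X (y : 'cV_m) (z : 'cV_n) :
  is_moore_penrose A X -> rdot (A *m z) (y - A *m (X *m y)) = 0.
Proof.
move=> [AXA _ AXh _]; rewrite rdotBr [in X in _ - X]mulmxA -AXh -rdot_adj.
by rewrite mulmxA AXA subrr.
Qed.

Lemma rdot_orthD n (a b : 'cV[R[i]]_n) :
  rdot a b = 0 -> rdot (a + b) (a + b) = rdot a a + rdot b b.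
Proof. by move=> ab; rewrite rdotDr !rdotDl (rdotC b a) ab addr0 add0r. Qed.

Lemma moore_penrose_contract m n (A : 'M[R[i]]_(m, n)) X (y : 'cV_m) :
  is_moore_penrose A X -> l2norm (A *m (X *m y)) <= l2norm y.
Proof.
move=> mp; rewrite le_l2norm.
have {3 4}-> : y = A *m (X *m y) + (y - A *m (X *m y)) by rewrite addrC subrK.
by rewrite rdot_orthD ?moore_penrose_orth // lerDl rdot_ge0.
Qed.

(** Pythagoras: y - A z is the sum of A (X y - z), in the range of A, and the residual, orthogonal
    to that range. *)
Lemma moore_penrose_min m n (A : 'M[R[i]]_(m, n)) X (y : 'cV_m) (z : 'cV_n) :
  is_moore_penrose A X -> l2norm (y - A *m (X *m y)) <= l2norm (y - A *m z).
Proof.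
move=> mp; rewrite le_l2norm.
have -> : y - A *m z = A *m (X *m y - z) + (y - A *m (X *m y)).
  by rewrite mulmxBr [RHS]addrC addrA subrK.
by rewrite [leRHS]rdot_orthD ?moore_penrose_orth // lerDr rdot_ge0.
Qed.

(** The bound on V^+ gives |z| <= c |V z|. Replacing V by W costs at most c e |z| <= |z| / 2, which
    is absorbed to give |z| <= 2 c |W z|. This yields injectivity and, with z = W^+ y and |W W^+ y|
    <= |y|, the bound on W^+. *)
Lemma moore_penrose_perturb m n (W V : 'M[R[i]]_(m, n)) (c e : R) :
  injective_mx V -> l2mxnorm (moore_penrose V) <= c ->
  (forall z : 'cV_n, l2norm ((W - V) *m z) <= e * l2norm z) -> c * e <= 2^-1 ->
  injective_mx W /\
  forall y : 'cV_m, l2norm (moore_penrose W *m y) <= 2 * c * l2norm y.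
Proof.
move=> injV Vc We ce.
have c0 : 0 <= c by apply: le_trans Vc; apply: l2mxnorm_ge0.
have key z : l2norm z <= 2 * c * l2norm (W *m z).
  have : l2norm z <= c * l2norm (V *m z).
    rewrite -[X in l2norm X <= _](moore_penroseK z injV).
    apply: le_trans (l2norm_mulmx _ _) _.
    by apply: ler_wpM2r => //; apply: l2norm_ge0.
  have -> : V *m z = W *m z - (W - V) *m z.
    by rewrite mulmxBl opprB addrC subrK.
  have h1 := l2normB (W *m z) ((W - V) *m z); have h2 := We z.
  have h3 : c * l2norm (W *m z - (W - V) *m z) <=
      c * l2norm (W *m z) + c * e * l2norm z.
    rewrite -mulrA -mulrDr; apply: ler_wpM2l => //; lra.
  have h4 : c * e * l2norm z <= 2^-1 * l2norm z.
    by apply: ler_wpM2r => //; apply: l2norm_ge0.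
  lra.
have injW : injective_mx W.
  move=> z Wz; apply: l2norm_eq0; apply/eqP; rewrite eq_le l2norm_ge0 andbT.
  by apply: le_trans (key z) _; rewrite Wz l2norm0 mulr0.
split=> // y; apply: le_trans (key _) _; apply: ler_wpM2l.
  by rewrite mulr_ge0.
exact/moore_penrose_contract/moore_penroseP.
Qed.

End MoorePenrose.

(** * Complex differentiability and the mean value inequality *)

Section Differentiation.
Context {R : realType}.

(** The library norm on column vectors is the largest modulus of an entry, with values in R[i]. This
    bound and [l2norm_le_normr] transfer estimates between it and [l2norm]. *)
Lemma normr_le_l2norm n (a : 'cV[R[i]]_n) : `|a| <= ((l2norm a)%:C)%C.
Proof.
have [->|a0] := eqVneq `|a| 0; first by rewrite ler0c l2norm_ge0.
have [[i j] /= aE] := mx_norm_neq0 a0;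
rewrite [leLHS]aE ord1 normr_normcE lecR.
exact: normc_le_l2norm.
Qed.

Lemma normr_coord_le n (a : 'cV[R[i]]_n) i : `|a i 0| <= `|a|.
Proof.
rewrite {2}/Num.norm /= mx_normE [leLHS](_ : _ = (`|a i 0|%:nng)%:num) //.
rewrite num_le.
exact: (@le_bigmax _ _ _ 0%:nng (fun ij => `|a ij.1 ij.2|%:nng) (i, 0)).
Qed.

(** The crude factor comes from n M^2 <= (n + 1)^2 M^2; it stays positive for n = 0, so dividing by
    it is safe. *)
Lemma l2norm_le_normr n (a : 'cV[R[i]]_n) :
  l2norm a <= n.+1%:R * complex.Re `|a|.
Proof.
have M0 : 0 <= complex.Re `|a| by have := normr_ge0 a; rewrite lecE => /andP[].
have aM i : ComplexField.Normc.normc (a i 0) <= complex.Re `|a|.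
  by have := normr_coord_le a i; rewrite normr_normcE lecE => /andP[].
rewrite -ler_sqr ?nnegrE ?l2norm_ge0 ?mulr_ge0 // sqr_l2norm /rdot.
under eq_bigr do rewrite -sqr_normc_ReIm.
apply: (@le_trans _ _ (\sum_(i < n) complex.Re `|a| ^+ 2)).
  by apply: ler_sum => i _; rewrite ler_sqr ?nnegrE ?normc_ge0.
rewrite sumr_const card_ord -[leLHS]mulr_natl exprMn; apply: ler_wpM2r.
  exact: sqr_ge0.
by rewrite -natrX ler_nat expnS mulSn ltnW // ltn_addr.
Qed.

Lemma derive_coord n (f : 'cV[R[i]]_n -> 'cV[R[i]]_n) y v j :
  derivable f y v -> 'D_v (fun y => f y j 0) y = ('D_v f y) j 0.
Proof.
move=> df; rewrite {1}/derive; apply: cvg_lim; first exact: norm_hausdorff.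
have h := continuous_cvg _ (@coord_continuous _ _ _ j 0 _) df.
have -> : (fun h => h^-1 *:
    (((fun y => f y j 0) \o shift y) (h *: v) - f y j 0)) =
    (fun h => (h^-1 *: ((f \o shift y) (h *: v) - f y)) j 0).
  by apply/funext => r; rewrite !mxE.
exact: h.
Qed.

Lemma diff_jacobian_mx n (f : 'cV[R[i]]_n -> 'cV[R[i]]_n) y d :
  differentiable f y -> 'd f y d = jacobian_mx f y *m d.
Proof.
move=> df; apply/colP => i; rewrite mxE.
have {1}-> : d = \sum_j d j 0 *: delta_mx j 0.
  by rewrite {1}[d]matrix_sum_delta; apply: eq_bigr => j _; rewrite big_ord1.
rewrite linear_sum summxE; apply: eq_bigr => j _.
rewrite linearZ !mxE mulrC; congr (_ * _).
rewrite derive_coord; last exact: diff_derivable.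
by rewrite deriveE.
Qed.

Lemma differentiable_expansion n (f : 'cV[R[i]]_n -> 'cV[R[i]]_n) y :
  differentiable f y -> forall e, 0 < e -> exists2 r, 0 < r &
  forall d, l2norm d <= r ->
    l2norm (f (y + d) - f y - jacobian_mx f y *m d) <= e * l2norm d.
Proof.
move=> df e e0; have [_ /eqaddoP h] := (diff_locallyP y f).1 df.
(* The division by n + 1 compensates the passage from the maximum norm to [l2norm]. *)
have e'0 : 0 < ((e / n.+1%:R)%:C)%C by rewrite ltcR divr_gt0.
have := h _ e'0; rewrite -nbhs_nearE => /nbhs_normP [r /= r0 hr].
have rR : ((complex.Re r)%:C)%C = r by apply/RRe_real/gtr0_real.
have Rr0 : 0 < complex.Re r by rewrite -ltcR rR.
(* The radius is halved because the ball around 0 is open while the condition on d is not strict. *)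
exists (complex.Re r / 2) => [|d dr]; first by rewrite divr_gt0.
have := hr d; rewrite /ball_ /= sub0r normrN => /(_ _)/wrap [].
  apply: le_lt_trans (normr_le_l2norm _) _; rewrite -rR ltcR.
  by apply: le_lt_trans dr _; rewrite ltr_pdivrMr // ltr_pMr // ltr1n.
rewrite /= !fctE (addrC d y) diff_jacobian_mx // opprD addrA => hd.
apply: le_trans (l2norm_le_normr _) _.
rewrite -ler_pdivlMl // mulrA -(mulrC e) -lecR.
apply: le_trans _ (le_trans hd _).
  by rewrite RRe_real // normr_real.
rewrite [leRHS]rmorphM; exact: (ler_wpM2l (ltW e'0) (normr_le_l2norm d)).
Qed.

Lemma l2norm_mvt n (f : 'cV[R[i]]_n -> 'cV[R[i]]_n) (G : 'M[R[i]]_n) y d M :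
  (forall t : R, 0 <= t <= 1 -> differentiable f (y + t%:C%C *: d)) ->
  (forall t : R, 0 <= t <= 1 ->
    l2norm (G *m (jacobian_mx f (y + t%:C%C *: d) *m d)) <= M) ->
  l2norm (G *m (f (y + d) - f y)) <= M.
Proof.
(* Pairing with v = G (f (y + d) - f y) itself reduces the claim to the scalar
   mean value theorem for t |-> Re <v, G f (y + t d)>. *)
move=> df bnd.
have alg (a b c k : R) :
  k != 0 -> c - k^-1 * (a - b) = - k^-1 * (a - b - k * c).
  by move=> k0; field.
set v := G *m (f (y + d) - f y).
pose p (t : R) := y + t%:C%C *: d.
pose phi (t : R) := rdot v (G *m f (p t)).
pose dphi (t : R) := rdot v (G *m (jacobian_mx f (p t) *m d)).
have Dphi (t : R) : 0 <= t <= 1 -> is_derive t 1 phi (dphi t).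
  move=> t01.
  (* f is differentiable in the complex sense; the derivative in the real parameter t is computed by
     hand from the expansion of f at [p t]. *)
  suff h : (fun h : R => h^-1 *: ((phi \o shift t) (h *: 1) - phi t)) @ 0^'
           --> dphi t.
    by split; [apply/cvg_ex; exists (dphi t) | apply: cvg_lim].
  apply/cvgrPdist_le => /= e e0.
  (* The added 1 keeps C positive; precision e / C bounds the error of the difference quotient by
     e. *)
  pose C := l2norm v * l2mxnorm G * l2norm d + 1.
  have C0 : 0 < C.
    by rewrite ltr_wpDl // !mulr_ge0 ?l2norm_ge0 ?l2mxnorm_ge0.
  have [r r0 hr] := differentiable_expansion (df t t01) (divr_gt0 e0 C0).
  near=> h.
  have h0 : h != 0 by near: h; exact: nbhs_dnbhs_neq.
  have hd : l2norm (h%:C%C *: d) <= r.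
    rewrite l2normZr -[r](@divfK _ (l2norm d + 1)); last first.
      by rewrite gt_eqF // ltr_wpDl ?l2norm_ge0.
    apply: ler_pM => //; rewrite ?l2norm_ge0 ?lerDl //.
    near: h; apply: dnbhs0_le; rewrite divr_gt0 // ltr_wpDl ?l2norm_ge0 //.
  have := hr _ hd; set E := (X in l2norm X) => hE.
  have -> : dphi t - h^-1 *: ((phi \o shift t) (h *: 1) - phi t) =
            - h^-1 * rdot v (G *m E).
    have -> : E = f (p (h + t)) - f (p t) -
        h%:C%C *: (jacobian_mx f (p t) *m d).
      by rewrite /E -scalemxAr /p [h + t]addrC rmorphD /= scalerDl addrA.
    rewrite !mulmxBr -scalemxAr !rdotBr rdotZr /dphi /phi /= /shift /=.
    rewrite /GRing.scale /= mulr1.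
    exact: alg.
  rewrite normrM normrN normfV -ler_pdivlMl ?invr_gt0 ?normr_gt0 // invrK.
  have nd w : `|rdot v w| <= l2norm v * l2norm w.
    rewrite ler_norml rdot_le andbT lerNl -rdotNr.
    by rewrite -(l2normN w) rdot_le.
  apply: le_trans (nd _) _.
  have h1 := l2norm_mulmx G E.
  apply: (@le_trans _ _
    (l2norm v * (l2mxnorm G * (e / C * (`|h| * l2norm d))))).
    apply: ler_wpM2l; rewrite ?l2norm_ge0 //.
    apply: le_trans h1 _; apply: ler_wpM2l; rewrite ?l2mxnorm_ge0 //.
    by rewrite -l2normZr.
  have -> : l2norm v * (l2mxnorm G * (e / C * (`|h| * l2norm d))) =
    `|h| * (e * (C^-1 * (l2norm v * l2mxnorm G * l2norm d))) by ring.
  apply: ler_wpM2l => //; rewrite ler_piMr ?(ltW e0) //.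
  by rewrite ler_pdivrMl // mulr1 /C lerDl.
have cphi : {within `[0, 1], continuous phi}.
  apply: derivable_within_continuous => t; rewrite in_itv /= => t01.
  by have [] := Dphi t t01.
have [|t] := @MVT R phi dphi 0 1 ltr01 _ cphi.
  by move=> t; rewrite in_itv /= => /andP[t0 t1]; apply: Dphi; rewrite !ltW.
rewrite in_itv /= subr0 mulr1 => /andP[t0 t1].
rewrite /phi -rdotBr -mulmxBr /p rmorph0 rmorph1 scale0r scale1r addr0.
rewrite -/v -sqr_l2norm => vE.
(* By the mean value theorem |v|^2 is [dphi t]. For v = 0 the claim is 0 <= M, read off at t = 0;
   otherwise Cauchy-Schwarz allows cancelling |v|. *)
have [->|v0] := eqVneq v 0.
  rewrite l2norm0; apply: le_trans (bnd 0 _); first exact: l2norm_ge0.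
  by rewrite lexx ler01.
rewrite -(ler_pM2l (l2norm_gt0 v0)) -expr2 vE.
apply: le_trans (rdot_le _ _) _; apply: ler_wpM2l; first exact: l2norm_ge0.
by apply: bnd; rewrite !ltW.
Unshelve. all: by end_near. Qed.

End Differentiation.

(** * Calculus of vector sequences that are o(E) *)

Definition osmall {R : realType} {n : nat} (E : nat -> R)
    (a : nat -> 'cV[R[i]]_n) : Prop :=
  forall e, 0 < e -> \forall m \near \oo, l2norm (a m) <= e * E m.

Section Osmall.
Context {R : realType}.
Implicit Types (n : nat) (E : nat -> R).

Lemma eq_osmall n E (a b : nat -> 'cV[R[i]]_n) :
  (forall m, b m = a m) -> osmall E a -> osmall E b.
Proof. by move=> ab oa e /oa; apply: filterS => m; rewrite ab. Qed.

Lemma osmallD n E (a b : nat -> 'cV[R[i]]_n) :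
  osmall E a -> osmall E b -> osmall E (fun m => a m + b m).
Proof.
move=> oa ob e e0; have e20 : 0 < e / 2 by rewrite divr_gt0.
near=> m; apply: le_trans (l2normD _ _) _; rewrite [e in leRHS]splitr mulrDl.
by apply: lerD; near: m; [exact: oa|exact: ob].
Unshelve. all: by end_near. Qed.

Lemma osmall_mulmx p n E (A : 'M[R[i]]_(p, n)) (a : nat -> 'cV[R[i]]_n) :
  osmall E a -> osmall E (fun m => A *m a m).
Proof.
move=> oa e e0; have A0 := l2mxnorm_ge0 A.
have A1 : 0 < l2mxnorm A + 1 by rewrite ltr_wpDl.
near=> m; apply: le_trans (l2norm_mulmx _ _) _.
have h : l2norm (a m) <= e / (l2mxnorm A + 1) * E m.
  by near: m; apply: oa; rewrite divr_gt0.
rewrite -[leRHS](@divfK _ (l2mxnorm A + 1)) ?gt_eqF // mulrC.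
apply: ler_pM; rewrite ?l2norm_ge0 ?lerDl //.
by rewrite mulrAC.
Unshelve. all: by end_near. Qed.

Lemma osmallZ n E (c : R[i]) (a : nat -> 'cV[R[i]]_n) :
  osmall E a -> osmall E (fun m => c *: a m).
Proof.
move=> /(osmall_mulmx c%:M); apply: eq_osmall => m.
by rewrite mul_scalar_mx.
Qed.

Lemma osmallB n E (a b : nat -> 'cV[R[i]]_n) :
  osmall E a -> osmall E b -> osmall E (fun m => a m - b m).
Proof.
move=> oa /(osmallZ (-1)) ob; apply: eq_osmall (osmallD oa ob) => m.
by rewrite scaleN1r.
Qed.

Lemma osmall_sum n E (I : Type) (r : seq I) (a : I -> nat -> 'cV[R[i]]_n) :
  (forall m, 0 <= E m) -> (forall i, osmall E (a i)) ->
  osmall E (fun m => \sum_(i <- r) a i m).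
Proof.
move=> E0 oa; elim: r => [|i r IH].
  move=> e e0; apply: nearW => m.
  by rewrite big_nil l2norm0 mulr_ge0 ?(ltW e0).
by apply: eq_osmall (osmallD (oa i) IH) => m; rewrite big_cons.
Qed.

(** Finitely many columns share one threshold. Precision e / (k + 1) per column adds up to at most
    e, and the denominator is nonzero also for k = 0. *)
Lemma osmall_mx n k E (A : nat -> 'M[R[i]]_(n, k)) :
  (forall m, 0 <= E m) -> (forall j, osmall E (fun m => col j (A m))) ->
  forall e, 0 < e ->
  \forall m \near \oo, forall z : 'cV_k,
    l2norm (A m *m z) <= e * E m * l2norm z.
Proof.
move=> E0 oA e e0; have k0 : 0 < k.+1%:R :> R by [].
have e'0 : 0 < e / k.+1%:R by rewrite divr_gt0.
have : \forall m \near \oo, forall j, l2norm (col j (A m)) <= e / k.+1%:R * E m.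
  by apply: filter_forall => j; exact: oA.
apply: filterS => m h z; apply: le_trans (l2norm_mulmx_col _ _) _.
apply: ler_wpM2r; first exact: l2norm_ge0.
apply: (@le_trans _ _ (\sum_(j < k) e / k.+1%:R * E m)); first exact: ler_sum.
rewrite sumr_const card_ord -[leLHS]mulr_natl mulrA; apply: ler_wpM2r => //.
by rewrite mulrCA ler_piMr ?(ltW e0) // ler_pdivrMr // mul1r ler_nat.
Qed.

End Osmall.

(** * Telescoped differences and polynomials in the Jacobian matrix *)

Lemma rre_u_telescope (R : realType) (N : nat) (x : nat -> 'cV[R[i]]_N) n k j :
  (j <= k)%N ->
  rre_W x n k *m (\col_i ((i < j)%N)%:R) = rre_u x (n + j) - rre_u x n.
Proof.
move=> jk; rewrite mulmx_cV_sum.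
(* The 0-1 vector selects the first j columns of W, whose sum telescopes. *)
transitivity (\sum_(i < k | (i < j)%N) rre_w x (n + i)).
  rewrite [RHS]big_mkcond /=; apply: eq_bigr => i _; rewrite mxE.
  have -> : col i (rre_W x n k) = rre_w x (n + i).
    by apply/colP => l; rewrite !mxE.
  by case: ifP => _; rewrite ?scale1r ?scale0r.
rewrite -(big_ord_widen k (fun i => rre_w x (n + i))) //.
rewrite -(big_mkord xpredT (fun i => rre_w x (n + i))).
under eq_bigr do rewrite /rre_w -addnS.
by rewrite (telescope_sumr (fun i => rre_u x (n + i))) // addn0.
Qed.

Section PolynomialResidual.
Context {R : realType} {N : nat}.

Lemma poly_sum_coef (A : nzRingType) (g : {poly A}) d :
  (size g <= d)%N -> g = \sum_(j < d) g`_j *: 'X^j.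
Proof.
move=> gd; rewrite -poly_def; apply/polyP => j; rewrite coef_poly.
by case: ltnP => // dj; rewrite nth_default // (leq_trans gd).
Qed.

Lemma horner_mx_sum (F : 'M[R[i]]_N.+1) d (c : 'I_d -> R[i]) :
  horner_mx F (\sum_j c j *: 'X^j) = \sum_j c j *: F ^+ j.
Proof.
rewrite rmorph_sum /=; apply: eq_bigr => j _.
by rewrite linearZ /= rmorphXn /= horner_mx_X.
Qed.

(** Minimality speaks of monic polynomials, so a nonzero q is first divided by its leading
    coefficient, which preserves its size and q(F) u = 0. *)
Lemma minpoly_wrt_eq0 (F : 'M[R[i]]_N.+1) u P (q : {poly R[i]}) :
  is_minpoly_wrt F u P -> horner_mx F q *m u = 0 -> (size q < size P)%N ->
  q = 0.
Proof.
move=> [_ _ Pmin] qu qP; apply/eqP/negPn/negP => q0; move: qP.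
have lq : lead_coef q != 0 by rewrite lead_coef_eq0.
rewrite ltnNge -(size_scale q (invr_neq0 lq)) Pmin //.
  by rewrite monicE lead_coefZ mulVf.
by rewrite linearZ /= -scalemxAl qu scaler0.
Qed.

(** A kernel vector z is read as the coefficients of a polynomial q of degree below k. Then (F -
    1)^2 q(F) u = 0, and cancelling the invertible F - 1 twice leaves q(F) u = 0. As q is smaller
    than the minimal polynomial, q = 0. *)
Lemma W_tilde_injective (F : 'M[R[i]]_N.+1) u P k :
  1 - F \in unitmx -> is_minpoly_wrt F u P -> (k < size P)%N ->
  injective_mx (W_tilde F u k).
Proof.
move=> uF minP kP z Wz; pose q := \sum_(j < k) z j 0 *: 'X^j.
have coefq (j : 'I_k) : q`_j = z j 0.
  rewrite coef_sum (bigD1 j) //= coefZ coefXn eqxx mulr1 big1 ?addr0 // => i ij.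
  rewrite coefZ coefXn [(_ == _)%N]eq_sym.
  by rewrite (negbTE (ij : i != j :> nat)) mulr0.
have sq : (size q <= k)%N.
  apply/leq_sizeP => j kj; rewrite coef_sum big1 // => i _.
  by rewrite coefZ coefXn gtn_eqF ?mulr0 // (leq_trans (ltn_ord i)).
suff q0 : q = 0.
  by apply/colP => j; rewrite -coefq q0 coef0 mxE.
apply: (minpoly_wrt_eq0 minP) (leq_ltn_trans sq kP).
have uF1 : F - 1 \in unitmx by rewrite -opprB -scaleN1r unitmxZ ?unitrN1.
suff : (F - 1) *m ((F - 1) *m (horner_mx F q *m u)) = 0.
  by move=> /(congr1 (mulmx (invmx (F - 1)))); rewrite mulKmx // mulmx0 =>
     /(congr1 (mulmx (invmx (F - 1)))); rewrite mulKmx // mulmx0.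
rewrite -Wz [RHS]mulmx_cV_sum horner_mx_sum mulmx_suml !mulmx_sumr.
apply: eq_bigr => j _; rewrite -scalemxAl -!scalemxAr; congr (_ *: _).
have -> : col j (W_tilde F u k) = (F - 1) ^+ 2 *m F ^+ j *m u.
  by apply/colP => i; rewrite !mxE.
by rewrite expr2 -mulmxE -!mulmxA.
Qed.

(** As the coefficients of g sum to 1, the right side is u_n + sum_j g_j (u_(n+j) - u_n), and by
    telescoping each difference lies in the range of W. The vector z depends on g but not on n. *)
Lemma rre_W_residual (x : nat -> 'cV[R[i]]_N) k (g : {poly R[i]}) :
  (size g <= k.+1)%N -> g.[1] = 1 -> exists z : 'cV_k, forall n,
  rre_u x n - rre_W x n k *m z = \sum_(j < k.+1) g`_j *: rre_u x (n + j).
Proof.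
move=> gk g1; exists (- \sum_(j < k.+1) g`_j *: \col_i ((i < j)%N)%:R) => n.
rewrite mulmxN opprK mulmx_sumr.
under eq_bigr => j _ do
  rewrite -scalemxAr rre_u_telescope -1?ltnS // scalerBr.
rewrite sumrB -scaler_suml.
have -> : \sum_(j < k.+1) g`_j = 1.
  rewrite -g1 (horner_coef_wide _ gk).
  by apply: eq_bigr => j _; rewrite expr1n mulr1.
by rewrite scale1r addrC subrK.
Qed.

End PolynomialResidual.

(** * First-order asymptotics of the errors and of the RRE approximation *)

Section ReducedRank.
Context {R : realType} {N : nat} {f : 'cV[R[i]]_N.+1 -> 'cV[R[i]]_N.+1}.
Context {s : 'cV[R[i]]_N.+1} {x : nat -> 'cV[R[i]]_N.+1} {L : R}.
Local Notation Ft := (jacobian_mx f s).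
Local Notation G := (1 - Ft).
Local Notation E := (fun n => Gnorm G (x n - s)).
Context (uG : G \in unitmx) (df : differentiable f s) (fs : s = f s).
Context (hx : forall m, x m.+1 = f (x m)).
Context (L0 : 0 <= L) (L1 : L < 1).
Context (contr : forall m, E m.+1 <= L * E m).

Lemma Gnorm_ge0 m : 0 <= E m.
Proof. exact: l2norm_ge0. Qed.

Lemma err_mono m i : E (m + i)%N <= E m.
Proof.
elim: i => [|i IH]; first by rewrite addn0.
rewrite addnS; apply: le_trans (contr _) _; apply: le_trans IH.
by rewrite ler_piMl ?Gnorm_ge0 // ltW.
Qed.

Lemma err_lt e : 0 < e -> \forall m \near \oo, E m <= e.
Proof.
move=> e0.
have h m : E m <= L ^+ m * E 0%N.
  elim: m => [|m IH]; first by rewrite expr0 mul1r.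
  apply: le_trans (contr _) _; rewrite exprS -mulrA.
  exact: ler_wpM2l.
have c0 : L ^+ m * E 0%N @[m --> \oo] --> 0 * E 0%N.
  by apply: cvgMl; apply: cvg_expr; rewrite ger0_norm.
rewrite mul0r in c0; move/cvgrPdist_le: c0 => /(_ _ e0); apply: filterS => m.
rewrite sub0r normrN ger0_norm => [|//]; first exact: le_trans.
by rewrite mulr_ge0 ?exprn_ge0 ?Gnorm_ge0.
Qed.

Lemma l2norm_le_Gnorm v : l2norm v <= l2mxnorm (invmx G) * Gnorm G v.
Proof. by rewrite -{1}[v](mulKmx uG) l2norm_mulmx. Qed.

Lemma Gnorm_gt0 v : v != 0 -> 0 < Gnorm G v.
Proof.
move=> v0; apply: l2norm_gt0; apply: contraNneq v0 => Gv.
by rewrite -[v](mulKmx uG) Gv mulmx0.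
Qed.

(** As s = f s, this is the remainder of the expansion of f at s for the displacement x_(m+i) - s.
    That displacement is at most a constant times E m, since the errors do not increase, and so it
    eventually enters the radius of the expansion. *)
Lemma osmall_linearize i :
  osmall E (fun m => x (m + i.+1)%N - s - Ft *m (x (m + i)%N - s)).
Proof.
move=> e e0; set K := l2mxnorm (invmx G).
have K0 : 0 <= K by exact: l2mxnorm_ge0.
have K1 : 0 < K + 1 by rewrite ltr_wpDl.
have e'0 : 0 < e / (K + 1) by rewrite divr_gt0.
have [r r0 hr] := differentiable_expansion df e'0.
have r'0 : 0 < r / (K + 1) by rewrite divr_gt0.
have := err_lt r'0; apply: filterS => m Em.
have dm : l2norm (x (m + i)%N - s) <= (K + 1) * E m.
  apply: le_trans (l2norm_le_Gnorm _) _; apply: ler_pM.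
  - exact: K0.
  - exact: l2norm_ge0.
  - by rewrite -/K lerDl.
  - exact: err_mono.
have := hr (x (m + i)%N - s) => /(_ _)/wrap [].
  by apply: le_trans dm _; rewrite -ler_pdivlMl // mulrC.
rewrite (addrC s) subrK -fs addnS hx => h; apply: le_trans h _.
by rewrite -mulrA ler_pM2l // ler_pdivrMl.
Qed.

Lemma osmall_err i :
  osmall E (fun m => x (m + i)%N - s - Ft ^+ i *m (x m - s)).
Proof.
elim: i => [|i IH].
  move=> e e0; apply: nearW => m.
  by rewrite addn0 expr0 mul1mx subrr l2norm0 mulr_ge0 ?Gnorm_ge0 ?(ltW e0).
apply: eq_osmall (osmallD (osmall_linearize i) (osmall_mulmx Ft IH)) => m.
rewrite [Ft *m (_ - _ *m _)]mulmxBr [Ft *m (_ *m _)]mulmxA mulmxE.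
by rewrite -exprS addrA subrK.
Qed.

Lemma osmall_u j :
  osmall E (fun m => rre_u x (m + j) - (Ft - 1) *m Ft ^+ j *m (x m - s)).
Proof.
apply: eq_osmall (osmallB (osmall_err j.+1) (osmall_err j)) => m.
rewrite /rre_u addnS mulmxBl mul1mx mulmxE -exprS mulmxBl.
by rewrite [in RHS]opprD addrACA -opprD [- (_ - s)]opprB addrA subrK.
Qed.

Lemma osmall_w j :
  osmall E (fun m => rre_w x (m + j) - (Ft - 1) ^+ 2 *m Ft ^+ j *m (x m - s)).
Proof.
apply: eq_osmall (osmallB (osmall_u j.+1) (osmall_u j)) => m.
rewrite /rre_w addnS.
have -> : (Ft - 1) ^+ 2 *m Ft ^+ j =
    (Ft - 1) *m Ft ^+ j.+1 - (Ft - 1) *m Ft ^+ j.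
  have -> : (Ft - 1) *m Ft ^+ j.+1 - (Ft - 1) *m Ft ^+ j =
      (Ft - 1) * ((Ft - 1) * Ft ^+ j).
    by rewrite !mulmxE [X in _ = _ * X]mulrBl mul1r -exprS mulrBr.
  by rewrite mulmxE expr2 mulrA.
by rewrite mulmxBl [in RHS]opprD addrACA -opprD.
Qed.

(** The leading terms cancel exactly: G = - (F - 1), so G (F - 1) + (F - 1)^2 = 0. *)
Lemma osmall_Gu_w j :
  osmall E (fun m => G *m rre_u x (m + j) + rre_w x (m + j)).
Proof.
apply: eq_osmall (osmallD (osmall_mulmx G (osmall_u j)) (osmall_w j)) => m.
rewrite [X in _ = X + _]mulmxBr addrACA -opprD.
rewrite [G *m (_ *m (x m - s))]mulmxA [G *m (_ *m _)]mulmxA -mulmxDl -mulmxDl.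
have -> : G *m (Ft - 1) + (Ft - 1) ^+ 2 = 0.
  by rewrite expr2 mulmxE -mulrDl -[G]opprB addNr mul0r.
by rewrite !mul0mx subr0.
Qed.

(** Moving F - 1 past the powers of F turns the leading terms into g(F) applied to (F - 1) (x_m -
    s), a vector of l2 norm exactly E m. *)
Lemma poly_residual_le (g : {poly R[i]}) k :
  (size g <= k.+1)%N -> forall e, 0 < e -> \forall m \near \oo,
  l2norm (\sum_(j < k.+1) g`_j *: rre_u x (m + j)) <=
    (l2mxnorm (horner_mx Ft g) + e) * E m.
Proof.
move=> gk e e0.
have h := @osmall_sum _ _ E _ (index_enum 'I_k.+1)
  (fun j m => g`_j *: (rre_u x (m + j) - (Ft - 1) *m Ft ^+ j *m (x m - s)))
  Gnorm_ge0 (fun j => osmallZ g`_j (osmall_u j)).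
apply: filterS (h _ e0) => m hm.
have -> : \sum_(j < k.+1) g`_j *: rre_u x (m + j) =
  horner_mx Ft g *m ((Ft - 1) *m (x m - s)) +
  \sum_(j < k.+1)
    g`_j *: (rre_u x (m + j) - (Ft - 1) *m Ft ^+ j *m (x m - s)).
  rewrite [in X in X *m _](poly_sum_coef gk) horner_mx_sum mulmx_suml.
  rewrite -big_split.
  apply: eq_bigr => j _ /=; rewrite -scalemxAl -scalerDr; congr (_ *: _).
  suff -> : (Ft - 1) *m Ft ^+ j = Ft ^+ j *m (Ft - 1).
    by rewrite -mulmxA addrC subrK.
  by rewrite !mulmxE mulrBl mulrBr mul1r mulr1 -exprS -exprSr.
apply: le_trans (l2normD _ _) _; rewrite mulrDl; apply: lerD => //.
apply: le_trans (l2norm_mulmx _ _) _; apply: ler_wpM2l.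
  exact: l2mxnorm_ge0.
by rewrite -l2normN -mulNmx opprB.
Qed.

Lemma rre_error_le (k : nat) (eta : R) (g : {poly R[i]}) :
  (forall n, x n != s) ->
  (forall n, injective_mx (W_tilde Ft (x n - s) k)) ->
  0 < eta ->
  (forall n, l2mxnorm (moore_penrose (W_tilde Ft (x n - s) k)) <= eta / E n) ->
  (size g <= k.+1)%N -> g.[1] = 1 -> forall e, 0 < e ->
  \forall n \near \oo,
    Gnorm G (rre x n k - s) <= (l2mxnorm (horner_mx Ft g) + e) * E n.
Proof.
move=> xs injW eta0 Weta gk g1 e e0.
have E0 n : 0 < E n by apply: Gnorm_gt0; rewrite ?subr_eq0.
have E0' n : 0 <= E n by exact: ltW.
(* The three error terms below use up e', e' and 4 eta e', in total e. *)
pose e' := e / (2 + 4 * eta).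
have c0 : 0 < 2 + 4 * eta by rewrite addr_gt0 // mulr_gt0.
have e'0 : 0 < e' by rewrite divr_gt0.
have [z hz] := rre_W_residual x gk g1.
(* This precision times the bound eta / E n on the pseudoinverse is exactly the 1/2 that
   [moore_penrose_perturb] asks for. *)
have hW : \forall n \near \oo, forall z : 'cV_k,
    l2norm ((rre_W x n k - W_tilde Ft (x n - s) k) *m z) <=
    (2 * eta)^-1 * E n * l2norm z.
  apply: osmall_mx => // [j|]; last by rewrite invr_gt0 mulr_gt0.
  apply: eq_osmall (osmall_w j) => m; apply/colP => i.
  by rewrite !mxE; congr (_ - _); rewrite -[RHS]mxE.
have hGUW : \forall n \near \oo, forall z : 'cV_k,
    l2norm ((G *m rre_U x n k + rre_W x n k) *m z) <= e' * E n * l2norm z.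
  apply: osmall_mx => // j.
  apply: eq_osmall (osmall_Gu_w j) => m; apply/colP => i.
  rewrite !mxE; congr (_ + _).
  by apply: eq_bigr => l _; rewrite !mxE.
have ou : osmall E (fun n => G *m (x n - s) + rre_u x n).
  apply: eq_osmall (osmall_u 0) => n.
  by rewrite addn0 expr0 mulmx1 -[Ft - 1]opprB mulNmx opprK addrC.
near=> n.
have [injWn mpW] : injective_mx (rre_W x n k) /\ forall y : 'cV_N.+1,
    l2norm (moore_penrose (rre_W x n k) *m y) <= 2 * (eta / E n) * l2norm y.
  apply: (@moore_penrose_perturb _ _ _ _ (W_tilde Ft (x n - s) k) _
    ((2 * eta)^-1 * E n)) => //; first by near: n.
  have en := E0 n; have -> : eta / E n * ((2 * eta)^-1 * E n) = 2^-1.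
    by field; rewrite !gt_eqF.
  by [].
(* u_n is - G (x_n - s) up to o(E n); precision 1 gives the factor 2. *)
have un : l2norm (rre_u x n) <= 2 * E n.
  have h : l2norm (G *m (x n - s) + rre_u x n) <= 1 * E n.
    by near: n; exact: ou.
  rewrite -[rre_u x n](addKr (G *m (x n - s))) addrC.
  apply: le_trans (l2normB _ _) _; rewrite /Gnorm in h *; lra.
set xi := moore_penrose (rre_W x n k) *m rre_u x n.
have xin : l2norm xi <= 4 * eta.
  apply: le_trans (mpW _) _.
  apply: (@le_trans _ _ (2 * (eta / E n) * (2 * E n))).
    by apply: ler_wpM2l un; rewrite mulr_ge0 // divr_ge0 ?(ltW eta0).
  have en := E0 n; suff -> : 2 * (eta / E n) * (2 * E n) = 4 * eta by [].
  by field; rewrite !gt_eqF.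
have -> : Gnorm G (rre x n k - s) = l2norm
    ((G *m (x n - s) + rre_u x n) - (rre_u x n - rre_W x n k *m xi)
     - (G *m rre_U x n k + rre_W x n k) *m xi).
  rewrite /Gnorm /rre -mulmxA -/xi; congr l2norm.
  (* Here a is G (x_n - s), t is G U xi, u is u_n and w is W xi; the inserted u and w cancel. *)
  have alg (V : zmodType) (a u w t : V) : a - t = a + u - (u - w) - (t + w).
    rewrite opprB addrA [a + u + w]addrAC addrK opprD [- t - w]addrC.
    by rewrite addrA addrK.
  by rewrite [x n - _ - s]addrAC mulmxBr mulmxDl -mulmxA -alg.
have h1 : l2norm (G *m (x n - s) + rre_u x n) <= e' * E n.
  by near: n; exact: ou.
have h2 : l2norm (rre_u x n - rre_W x n k *m xi) <=
    (l2mxnorm (horner_mx Ft g) + e') * E n.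
  (* xi minimizes the residual, so it does no worse than the vector z built from g. *)
  apply: (@le_trans _ _ (l2norm (rre_u x n - rre_W x n k *m z))).
    exact/moore_penrose_min/moore_penroseP.
  by rewrite hz; near: n; exact: poly_residual_le.
have h3 : l2norm ((G *m rre_U x n k + rre_W x n k) *m xi) <=
    e' * E n * (4 * eta).
  apply: (@le_trans _ _ (e' * E n * l2norm xi)).
    (* xi depends on n, so it is generalized to reach the bound uniform in the vector. *)
    by move: (xi); near: n.
  by apply: ler_wpM2l; rewrite // mulr_ge0 // ltW.
apply: le_trans (l2normB _ _) _; apply: le_trans (lerD (l2normB _ _) h3) _.
apply: le_trans (lerD (lerD h1 h2) (lexx _)) _.
rewrite [e in leRHS](_ : _ = e' * (2 + 4 * eta)); last first.
  by rewrite divfK // gt_eqF.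
rewrite le_eqVlt; apply/orP; left; apply/eqP.
by generalize (E n) (l2mxnorm (horner_mx Ft g)) e' => a b c; ring.
Unshelve. all: by end_near. Qed.

End ReducedRank.

(** * Nonsingularity of G, the quantity theta_k and passage to the limit *)

Lemma spectral_radius_unitmx (R : realType) (N : nat) (F : 'M[R[i]]_N.+1) :
  spectral_radius F < 1 -> 1 - F \in unitmx.
Proof.
move=> rho1; apply: contraLR rho1 => nuF; rewrite -leNgt.
have eig1 : eigenvalue F 1.
  apply/eigenvalueP; move: nuF; rewrite -row_free_unit -kermx_eq0.
  move=> /rowV0Pn [v /sub_kermxP vF v0]; exists v => //.
  move: vF; rewrite mulmxBr mulmx1 scale1r => /eqP.
  by rewrite subr_eq0 => /eqP.
apply: ub_le_sup; last by exists 1 => //; exact: ComplexField.Normc.normc1.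
(* Eigenvalues are roots of the characteristic polynomial, so the sum of the moduli of its roots
   bounds the set whose supremum is the spectral radius. *)
have [rs rsP] := closed_field_poly_normal (char_poly F).
exists (\sum_(a <- rs) ComplexField.Normc.normc a) => _ [a /= aF <-].
have : a \in rs.
  rewrite -root_prod_XsubC; move: aF; rewrite eigenvalue_root_char rsP.
  by rewrite (monicP (char_poly_monic F)) scale1r.
move=> ars; rewrite (big_rem a) //= lerDl; apply: sumr_ge0 => b _.
exact: normc_ge0.
Qed.

(** Applied to F, which commutes with G = 1 - F, this carries the bound L over to the plain l2
    norm. *)
Lemma Gmxnorm_comm (R : realType) (N : nat) (G A : 'M[R[i]]_N.+1) :
  G \in unitmx -> G *m A = A *m G -> Gmxnorm G A = l2mxnorm A.
Proof. by move=> uG GA; rewrite /Gmxnorm GA mulmxK. Qed.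

Lemma Gnorm_mulmx (R : realType) (N : nat) (G A : 'M[R[i]]_N.+1) v :
  G \in unitmx -> Gnorm G (A *m v) <= Gmxnorm G A * Gnorm G v.
Proof.
move=> uG; rewrite /Gnorm -{1}[v](mulKmx uG) !mulmxA.
rewrite -[G *m A *m invmx G *m G *m v]mulmxA.
exact: l2norm_mulmx.
Qed.

Lemma theta_le (R : realType) (N : nat) (F : 'M[R[i]]_N.+1) k
    (g : {poly R[i]}) :
  (size g <= k.+1)%N -> g.[1] = 1 -> theta F k <= l2mxnorm (horner_mx F g).
Proof.
move=> gk g1; apply: ge_inf; last by exists g.
by exists 0 => _ [h _ <-]; apply: l2mxnorm_ge0.
Qed.

Lemma theta_approx (R : realType) (N : nat) (F : 'M[R[i]]_N.+1) k e :
  0 < e -> exists g : {poly R[i]}, [/\ (size g <= k.+1)%N, g.[1] = 1 &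
    l2mxnorm (horner_mx F g) < theta F k + e].
Proof.
move=> e0; pose S := [set l2mxnorm (horner_mx F g) |
  g in [set g : {poly R[i]} | (size g <= k.+1)%N /\ g.[1] = 1]].
have infS : has_inf S.
  split; first by exists (l2mxnorm (horner_mx F 1)); exists 1 => //=;
    rewrite size_poly1 hornerC.
  by exists 0 => _ [g _ <-]; apply: l2mxnorm_ge0.
by have [_ [g [gk g1] <-] ge] := inf_adherent e0 infS; exists g.
Qed.

(** The limit superior is an infimum of suprema over sets of the filter, and the indices with u n <=
    l + e form such a set. *)
Lemma limn_esup_le_near (R : realType) (u : nat -> R) (l : R) :
  (forall e, 0 < e -> \forall n \near \oo, u n <= l + e) ->
  (limn_esup (fun n => (u n)%:E) <= l%:E)%E.
Proof.
move=> h; apply/lee_addgt0Pr => e e0; apply: ge_ereal_inf.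
exists (ereal_sup [set (u n)%:E | n in [set n | u n <= l + e]]).
  by exists [set n | u n <= l + e] => //; exact: h.
by apply: ge_ereal_sup => _ [n /= un <-]; rewrite -EFinD lee_fin.
Qed.

Lemma cvg_l2norm (R : realType) (N : nat) (y : nat -> 'cV[R[i]]_N) s :
  (forall e, 0 < e -> \forall n \near \oo, l2norm (y n - s) <= e) ->
  y n @[n --> \oo] --> s.
Proof.
move=> h; apply/cvgrPdist_le => e e0.
have eR : ((complex.Re e)%:C)%C = e by apply/RRe_real/gtr0_real.
have Re0 : 0 < complex.Re e by rewrite -ltcR eR.
apply: filterS (h _ Re0) => n hn.
rewrite distrC -eR; apply: le_trans (normr_le_l2norm _) _.
by rewrite lecR.
Qed.

(** * Contraction on the ball and the limits of the RRE errors *)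

Lemma Gball_segment (R : realType) (N : nat) (G : 'M[R[i]]_N) s d delta t :
  Gnorm G d <= delta -> 0 <= t <= 1 -> Gball G s delta (s + t%:C%C *: d).
Proof.
move=> dd /andP[t0 t1]; rewrite /Gball /= addrC addKr /Gnorm -scalemxAr.
rewrite l2normZr ger0_norm //; apply: le_trans dd.
by rewrite ler_piMl // l2norm_ge0.
Qed.

Theorem theorem5p2 (R : realType) (N : nat)
    (f : 'cV[R[i]]_N.+1 -> 'cV[R[i]]_N.+1) (s : 'cV[R[i]]_N.+1)
    (x : nat -> 'cV[R[i]]_N.+1) (delta L : R) (k : nat) :
  let F := jacobian_mx f in
  let Ft := F s in
  let G := 1 - Ft in
  let B := Gball G s delta in
  let eps := fun n => x n - s in
  s = f s ->
  spectral_radius Ft < 1 ->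
  0 < delta ->
  (* (A1) *)
  twice_continuously_differentiable_on B f ->
  (* (A2) *)
  Gmxnorm G Ft <= L ->
  is_max [set Gmxnorm G (F y) | y in B] L ->
  L < 1 ->
  (* (A3) *)
  B (x 0%N) ->
  (forall m, x m.+1 = f (x m)) ->
  (1 <= k)%N ->
  (forall n, eps n != 0 /\
     exists2 P, is_minpoly_wrt Ft (eps n) P & (k <= (size P).-1)%N) ->
  (* (A4) *)
  (exists2 eta : R, 0 < eta & forall n,
     l2mxnorm (moore_penrose (W_tilde Ft (eps n) k)) <= eta / Gnorm G (eps n)) ->
  rre x n k @[n --> \oo] --> s /\
  (limn_esup (fun n => (Gnorm G (rre x n k - s) / Gnorm G (eps n))%:E)
     <= (theta Ft k)%:E)%E /\
  theta Ft k < 1.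
Proof.
move=> F Ft G B eps fs rho delta0 [A1 _ _] FtL [_ maxL] L1 Bx0 hx k1 minP.
move=> [eta eta0 A4].
have uG : G \in unitmx by exact: spectral_radius_unitmx.
have GnL y v : B y -> Gnorm G (F y *m v) <= L * Gnorm G v.
  move=> By; apply: le_trans (Gnorm_mulmx _ _ uG) _; apply: ler_wpM2r.
    exact: l2norm_ge0.
  by apply: maxL; exists y.
have L0 : 0 <= L by apply: le_trans FtL; apply: l2mxnorm_ge0.
have dfB y : B y -> differentiable f y.
  by move=> /A1 /nbhs_singleton.
(* Mean value inequality along the segment from s to y, which stays inside the ball. *)
have contr1 y : B y -> Gnorm G (f y - s) <= L * Gnorm G (y - s).
  move=> By; have seg t : 0 <= t <= 1 -> B (s + t%:C%C *: (y - s)).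
    exact: Gball_segment.
  have := @l2norm_mvt _ _ f G s (y - s) (L * Gnorm G (y - s)).
  rewrite [s + _]addrC subrK -fs; apply => t t01.
    exact/dfB/seg.
  exact/GnL/seg.
have Bx m : B (x m).
  elim: m => [|m Bm]; first exact: Bx0.
  have h := contr1 _ Bm; rewrite -hx in h.
  rewrite /B /Gball /= in Bm *; apply: (le_trans h); apply: le_trans Bm.
  by rewrite ler_piMl ?l2norm_ge0 // ltW.
have Bs : B s.
  by rewrite /B /Gball /= subrr /Gnorm mulmx0 l2norm0 ltW.
have contr m : Gnorm G (x m.+1 - s) <= L * Gnorm G (x m - s).
  by rewrite hx; apply/contr1/Bx.
have xs n : x n != s by have [] := minP n; rewrite subr_eq0.
have injW n : injective_mx (W_tilde Ft (x n - s) k).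
  have [_ [P Pmin kP]] := minP n; apply: (W_tilde_injective uG Pmin).
  (* k >= 1 rules out [size P = 0], where the truncated predecessor is 0. *)
  by case: (size P) kP => //; case: (k) k1.
have key (g : {poly R[i]}) : (size g <= k.+1)%N -> g.[1] = 1 ->
    forall e, 0 < e ->
    \forall n \near \oo, Gnorm G (rre x n k - s) <=
      (l2mxnorm (horner_mx Ft g) + e) * Gnorm G (eps n).
  exact: (rre_error_le uG (dfB s Bs) fs hx L0 L1 contr xs injW eta0 A4).
have E0 n : 0 < Gnorm G (eps n) by apply: Gnorm_gt0; rewrite ?subr_eq0.
(* The polynomial X is admissible because k >= 1; it serves both the convergence and theta_k < 1. *)
have sX : (size ('X : {poly R[i]}) <= k.+1)%N by rewrite size_polyX.
have X1 : ('X : {poly R[i]}).[1] = 1 by rewrite hornerX.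
have FtL' : l2mxnorm Ft <= L.
  rewrite -(Gmxnorm_comm uG) //.
  by rewrite /G mulmxE mulrBl mulrBr mul1r mulr1.
split; [|split].
- apply: cvg_l2norm => e e0; set K := l2mxnorm (invmx G).
  have K0 : 0 <= K by exact: l2mxnorm_ge0.
  have c0 : 0 < K * (L + 1) + 1 by rewrite ltr_wpDl // mulr_ge0 // addr_ge0.
  have e'0 : 0 < e / (K * (L + 1) + 1) by rewrite divr_gt0.
  (* With g = X and precision 1 the error is at most (L + 1) E n. *)
  have := err_lt L0 L1 contr e'0; have := key _ sX X1 1 ltr01.
  apply: filterS2 => n; rewrite horner_mx_X => h1 h2.
  apply: le_trans (l2norm_le_Gnorm uG _) _.
  apply: (@le_trans _ _ (K * ((L + 1) * Gnorm G (eps n)))).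
    apply: ler_wpM2l => //; apply: le_trans h1 _.
    by apply: ler_wpM2r; [exact: ltW|rewrite lerD2r].
  rewrite mulrA; apply: (@le_trans _ _ ((K * (L + 1) + 1) * Gnorm G (eps n))).
    by apply: ler_wpM2r; [exact: ltW|rewrite lerDl].
  by rewrite -ler_pdivlMl // mulrC.
- apply: limn_esup_le_near => e e0.
  (* One half of e pays for the near-minimizer g, the other for the asymptotic bound. *)
  have e20 : 0 < e / 2 by rewrite divr_gt0.
  have [g [gk g1 ge]] := theta_approx Ft k e20.
  apply: filterS (key g gk g1 _ e20) => n h.
  rewrite ler_pdivrMr //; apply: le_trans h _.
  apply: ler_wpM2r; first exact: ltW.
  by rewrite [e in leRHS]splitr addrA lerD2r ltW.
- apply: le_lt_trans (theta_le Ft sX X1) _; rewrite horner_mx_X.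
  exact: le_lt_trans FtL' L1.
Qed.
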